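(* Let $(\bar{\mathcal N},\bar{\mathcal A})$ be the constraint graph of a railway timetabling instance, with integer time windows $[l_{ij},u_{ij}]$ for $(i,j)\in\bar{\mathcal A}$, trip arcs $\bar{\mathcal A}_{\mathrm{trip}}\subset\bar{\mathcal A}$, real coefficients $c_{ij}$ for $(i,j)\in\bar{\mathcal A}_{\mathrm{trip}}$, and a positive integer $m$. Assume that the linear program $$ \begin{array}{ll} \text{minimize} & \sum_{(i,j)\in\bar{\mathcal A}_{\mathrm{trip}}} c_{ij}(x_j-x_i)\\ \text{subject to} & l_{ij}\le x_j-x_i\le u_{ij}\quad\text{for all }(i,j)\in\bar{\mathcal A},\\ & 0\le x_i\le m\quad\text{for all } i\in\bar{\mathcal N}, \end{array} $$ with decision vector $x=(x_i)_{i\in\bar{\mathcal N}}\in\mathbb R^{|\bar{\mathcal N}|}$, is feasible. Then it has an integral optimal solution, i.e. an optimal solution $x$ with $x_i\in\mathbb Z$ for all $i\in\bar{\mathcal N}$.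
   Context: All sets are finite. The constraint graph is the directed graph $(\bar{\mathcal N},\bar{\mathcal A})$ obtained from a railway timetabling instance as follows. Nodes: each node $i\in\bar{\mathcal N}$ is an event (the arrival or the departure of some train at or from some platform), and the variable $x_i$ is the time of that event. Arcs: each timetable constraint (trip time on a track or a crossing-over, dwell time, connection, headway, total travel time) bounds the difference of two distinct event times. It is represented by an arc $(i,j)\in\bar{\mathcal A}$ from the earlier event $i$ to the later event $j$ and has the form $l_{ij}\le x_j-x_i\le u_{ij}$. Every arc joins two distinct nodes, and there is at most one arc between any two nodes. The bounds $l_{ij},u_{ij}$ are integers (times in seconds). The set $\bar{\mathcal A}_{\mathrm{trip}}\subset\bar{\mathcal A}$ consists of the arcs associated with trip time constraints. For $(i,j)\in\bar{\mathcal A}_{\mathrm{trip}}$, the real number $c_{ij}$ is the slope of an affine least-squares fit of the energy consumption of the trip as a function of the trip time $x_j-x_i$; it enters only as a given real number. The positive integer $m$ is an upper bound for all event times. *)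

(* Defs.v *)
From HB Require Import structures.
From mathcomp Require Import all_boot all_order all_algebra.
From mathcomp Require Import reals.

Set Implicit Arguments.
Unset Strict Implicit.
Unset Printing Implicit Defensive.

Import Order.TTheory GRing.Theory Num.Theory.
Local Open Scope ring_scope.

(* Nodes are the events.  The time windows [lower a, upper a] are functions on
   all ordered pairs, but only their values on arcs are ever used; no relation
   between [lower] and [upper] and no sign condition is imposed. *)
Record constraint_graph (N : finType) := ConstraintGraph {
  arcs : {set N * N};
  trip_arcs : {set N * N};
  lower : N * N -> int;
  upper : N * N -> int;
  arcs_loopless : forall i j : N, (i, j) \in arcs -> i != j;
  arcs_single : forall i j : N, (i, j) \in arcs -> (j, i) \notin arcs;
  trip_arcs_sub : trip_arcs \subset arcs
}.

Section LinearProgram.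
Variables (R : realType) (N : finType) (G : constraint_graph N).

Definition lp_objective (c : N * N -> R) (x : {ffun N -> R}) : R :=
  \sum_(a in trip_arcs G) c a * (x a.2 - x a.1).

Definition lp_feasible (m : nat) (x : {ffun N -> R}) : Prop :=
  (forall i j : N, (i, j) \in arcs G ->
     (lower G (i, j))%:~R <= x j - x i <= (upper G (i, j))%:~R) /\
  (forall i : N, 0 <= x i <= m%:R).

Definition lp_optimal (c : N * N -> R) (m : nat) (x : {ffun N -> R}) : Prop :=
  lp_feasible m x /\
  forall y : {ffun N -> R}, lp_feasible m y ->
    lp_objective c x <= lp_objective c y.

End LinearProgram.

(* Main.v *)
(** Round a feasible point [x] with a common threshold: [y i := floor (x i + t)]
    for some [0 <= t < 1].  Since the bounds are integers and [floor] is
    monotone and commutes with integer shifts, every such [y] is feasible.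
    Averaged over a uniform [t], [y] equals [x], so by linearity some [t] does
    not increase the objective.  Hence the minimum over the finitely many
    integral feasible points is the minimum of the linear program. *)

Require Import Defs.
From HB Require Import structures.
From mathcomp Require Import all_boot all_order all_algebra.
From mathcomp Require Import reals.
From mathcomp Require Import boolp ring lra.

Set Implicit Arguments.
Unset Strict Implicit.
Unset Printing Implicit Defensive.

Import Order.TTheory GRing.Theory Num.Theory.
Local Open Scope ring_scope.

(* A discrete layer-cake argument: the right-hand side is the integral over
   [r] in [0, b] of the sums on the left, so one of them is at most the mean.
   The induction peels off the lowest nonzero layer of [f]. *)
Lemma exists_superlevel_sum_le (R : realFieldType) (I : finType) (d f : I -> R)
    (b : R) :
  0 < b -> (forall i, 0 <= f i <= b) ->
  exists2 r : R, 0 < r <= b & b * (\sum_(i | r <= f i) d i) <= \sum_i d i * f i.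
Proof.
(* Induction on the size of the support of [f], with [b] general because peeling a layer also lowers
   the bound. *)
elim: {f}_.+1 {-2}f b (ltnSn #|[pred i | f i != 0]|) => // n IHn f b.
rewrite ltnS => supp_f b_gt0 f_bnd.
have f_ge0 i : 0 <= f i by case/andP: (f_bnd i).
case: (pickP [pred i | f i != 0]) => [i0 /= fi0|f0]; last first.
  exists b; rewrite ?b_gt0 ?lexx // !big1 ?mulr0 // => i.
    by move=> _; have /negbFE/eqP-> := f0 i; rewrite mulr0.
  by have /negbFE/eqP-> := f0 i; rewrite leNgt b_gt0.
case: (@arg_minP _ _ _ i0 [pred i | f i != 0] f fi0) => i1 /= fi1 min_i1.
set a := f i1 in fi1 min_i1.
have a_gt0 : 0 < a by rewrite lt_def fi1 f_ge0.
have a_le i : (a <= f i) = (f i != 0).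
  apply/idP/idP => [ai|/min_i1//].
  by rewrite gt_eqF ?(lt_le_trans a_gt0).
have a_le_b : a <= b by case/andP: (f_bnd i1).
pose S := \sum_(i | a <= f i) d i.
(* What remains of [f] above its least nonzero value [a]; the minimizer [i1] drops out of the
   support. *)
pose g i := if a <= f i then f i - a else 0.
have sum_g : \sum_i d i * f i = a * S + \sum_i d i * g i.
  rewrite mulr_sumr [X in X + _]big_mkcond -big_split /=; apply: eq_bigr => i _.
  rewrite /g; case: ifP => [_|]; first by ring.
  by rewrite a_le => /negbFE/eqP->; rewrite mulr0 addr0.
have [b_le_a|a_lt_b] := leP b a.
  have ab : a = b by apply/le_anti; rewrite a_le_b.
  exists a; first by rewrite a_gt0.
  rewrite sum_g -/S -ab big1 ?addr0 // => i _; rewrite /g.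
  case: ifP => ai; last by rewrite mulr0.
  have /andP[_ fb] := f_bnd i.
  have -> : f i = a by lra.
  by rewrite subrr mulr0.
have supp_g : (#|[pred i | g i != 0%R]| < n)%N.
  apply: leq_trans supp_f; apply: proper_card.
  apply/properP; split; last first.
    by exists i1; rewrite !inE // /g lexx subrr eqxx.
  by apply/subsetP => i; rewrite !inE /g -a_le; case: ifP => //; rewrite eqxx.
have g_bnd i : 0 <= g i <= b - a.
  have /andP[_ fb] := f_bnd i.
  by rewrite /g; case: ifP => ai; lra.
have [|r /andP[r_gt0 r_le] ler] := IHn g (b - a) supp_g _ g_bnd; first lra.
have level_g i : (r <= g i) = (a + r <= f i).
  rewrite /g; case: (leP a (f i)) => ai; first by rewrite lerBrDl.
  by rewrite !leNgt r_gt0 (lt_trans ai) // ltrDl.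
rewrite (eq_bigl _ _ level_g) in ler.
set T := \sum_(i | a + r <= f i) d i in ler.
(* By [ler] the right-hand side is at least [a * S + (b - a) * T], hence at least [b] times the
   smaller of [S] and [T]. *)
rewrite sum_g; have [ST|TS] := leP S T.
  exists a; first by rewrite a_gt0.
  rewrite -/S; nra.
exists (a + r); first by apply/andP; split; lra.
rewrite -/T; nra.
Qed.

(** Turns the common shift into a superlevel set of the fractional part: the shift [1 - r] reaches
    the next integer exactly from fractional parts at least [r]. *)
Lemma floorD_frac (R : realType) (x r : R) : 0 < r <= 1 ->
  (Num.floor (x + (1 - r)))%:~R
    = (Num.floor x)%:~R + (r <= x - (Num.floor x)%:~R)%R%:R :> R.
Proof.
move=> /andP[r_gt0 r_le1]; have := floor_itv x; set z := Num.floor x.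
rewrite intrD => /andP[zx xz].
case: leP => h; rewrite ?addr0.
  by rewrite -[1%:R]/(1%:~R) -intrD; congr _%:~R; apply: floor_def;
    rewrite !intrD; lra.
by congr _%:~R; apply: floor_def; rewrite intrD; lra.
Qed.

(** Collecting terms by node rather than by arc gives the form [\sum_i d i * x i] required by
    [exists_superlevel_sum_le]. *)
Lemma lp_objectiveE (R : realType) (N : finType) (G : constraint_graph N)
    (c : N * N -> R) (x : {ffun N -> R}) :
  lp_objective G c x
    = \sum_i (\sum_(a in trip_arcs G)
                 c a * ((a.2 == i)%:R - (a.1 == i)%:R)) * x i.
Proof.
have delta (k : N) : \sum_i (k == i)%:R * x i = x k.
  rewrite (bigD1 k) //= eqxx mul1r big1 ?addr0 // => i.
  by rewrite eq_sym => /negbTE->; rewrite mul0r.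
under [RHS]eq_bigr do rewrite mulr_suml.
rewrite exchange_big /=; apply: eq_bigr => a _.
under eq_bigr do rewrite -mulrA mulrBl.
by rewrite -mulr_sumr sumrB !delta.
Qed.

Lemma lp_feasible_floor (R : realType) (N : finType) (G : constraint_graph N)
    (m : nat) (t : R) (x : {ffun N -> R}) :
  0 <= t < 1 -> lp_feasible G m x ->
  lp_feasible G m ([ffun i => (Num.floor (x i + t))%:~R] : {ffun N -> R}).
Proof.
move=> /andP[t_ge0 t_lt1] [x_arc x_box].
have floor_shift (u v : R) (z : int) :
    u + z%:~R <= v -> Num.floor u + z <= Num.floor v.
  by move=> /le_floor; rewrite floorDrz ?intr_int // intrKfloor.
split=> [i j /x_arc|i]; rewrite !ffunE.
  move=> /andP[lx xu]; rewrite -intrB !ler_int lerBrDl lerBlDl.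
  (* The upper bound is a shift by the negated [upper], so [floor_shift] serves both sides. *)
  rewrite -[X in _ && X]lerBlDr floor_shift /=; last lra.
  by apply: floor_shift; rewrite intrN; lra.
have /andP[x_ge0 x_le] := x_box i.
rewrite ler0z floor_ge0 addr_ge0 //= -[m%:R]/((m%:Z)%:~R) ler_int.
(* Here [t < 1] matters: [x i + t < m + 1] keeps the floor at most [m]. *)
by rewrite -ltzD1 floor_lt_int intrD -[_%:~R]/(m%:R); lra.
Qed.

(** The codomain ['I_m.+1] leaves finitely many candidates, so that a minimum exists among them. *)
Lemma lp_feasible_round (R : realType) (N : finType) (G : constraint_graph N)
    (c : N * N -> R) (m : nat) (x : {ffun N -> R}) :
  lp_feasible G m x ->
  exists g : {ffun N -> 'I_m.+1},
    let y : {ffun N -> R} := [ffun i => (g i)%:R] in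
    lp_feasible G m y /\ lp_objective G c y <= lp_objective G c x.
Proof.
move=> x_feas.
pose d i := \sum_(a in trip_arcs G) c a * ((a.2 == i)%:R - (a.1 == i)%:R).
pose f i : R := x i - (Num.floor (x i))%:~R.
have [|i|r r_itv] := @exists_superlevel_sum_le R N d f 1; first exact: ltr01.
  by have := floor_itv (x i); rewrite /f intrD; lra.
rewrite mul1r => le_sum.
pose y : {ffun N -> R} := [ffun i => (Num.floor (x i + (1 - r)))%:~R].
have y_feas : lp_feasible G m y by apply: lp_feasible_floor => //; lra.
(* Feasibility of [y] puts each floor between 0 and [m], so neither the absolute value nor [inord]
   changes it. *)
pose g : {ffun N -> 'I_m.+1} :=
  [ffun i => inord `|Num.floor (x i + (1 - r))|%N].
exists g; have -> : [ffun i => (g i)%:R] = y.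
  apply/ffunP => i; have [_ /(_ i)] := y_feas; rewrite !ffunE => /andP[].
  case: (Num.floor _) => k; rewrite ler0z // => _.
  rewrite -[_%:~R]/(k%:R) ler_nat => km.
  by rewrite inordK.
split=> //; rewrite !lp_objectiveE -subr_ge0 -sumrB.
have -> : \sum_i (d i * x i - d i * y i)
        = \sum_i d i * f i - \sum_(i | r <= f i) d i.
  rewrite [X in _ - X]big_mkcond -sumrB /=; apply: eq_bigr => i _.
  by rewrite ffunE floorD_frac // /f; case: ifP => _ /=; ring.
by rewrite subr_ge0.
Qed.

Theorem proposition1 (R : realType) (N : finType) (G : constraint_graph N)
    (c : N * N -> R) (m : nat) (m_gt0 : (0 < m)%N)
    (feasible : exists x : {ffun N -> R}, lp_feasible G m x) :
  exists x : {ffun N -> R},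
    lp_optimal G c m x /\ (forall i : N, x i \is a Num.int).
Proof.
case: feasible => x0 /(lp_feasible_round c)[g0 [g0_feas _]].
pose real_of (g : {ffun N -> 'I_m.+1}) : {ffun N -> R} := [ffun i => (g i)%:R].
have /(arg_minP (fun g => lp_objective G c (real_of g)))
    [g /asboolP g_feas g_min] :
  [pred g | `[< lp_feasible G m (real_of g) >]] g0 by apply/asboolP.
exists (real_of g); split=> [|i]; last by rewrite ffunE natr_int.
split=> // x /(lp_feasible_round c)[h [h_feas h_le]].
by apply: le_trans h_le; apply: g_min; apply/asboolP.
Qed.
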